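(* Let $\alpha\in\mathbb N$, $k\in\mathbb Z_+$, let $d\in\mathbb N$ with $(p,d)=1$, and let $\chi$ be a Dirichlet character with conductor $d$. For $\beta\,(\neq1)\in X^*$ define $$\mu_{k,\beta,q}^{(\alpha)}(U)=\mu_{k,q}^{(\alpha)}(U)-\beta^{-1}\frac{[\beta^{-1}]_{q^\alpha}^k}{[\beta^{-1}]_q}\,\mu_{k,q^{1/\beta}}^{(\alpha)}(\beta U)$$ for compact open $U\subset X$, and define the operator $\chi^y$ on $f(q)$ by $\chi^yf(q)=\frac{[y]_{q^\alpha}^k}{[y]_q}\chi(y)f(q^y)$, the product $\chi^x\chi^y$ being the composition of operators. Then $$\int_{X^*}\chi(x)\,d\mu_{k,\beta,q}^{(\alpha)}(\beta x)=(1-\chi^p)\left(1-\frac1\beta\chi^{1/\beta}\right)\widetilde\beta_{k,\chi,q}^{(\alpha)}.$$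
   Context: $p$ is a fixed prime; $\mathbb C_p$ is the completion of an algebraic closure of $\mathbb Q_p$, with $|p|_p=1/p$. $\mathbb N$ is the set of positive integers, $\mathbb Z_+=\mathbb N\cup\{0\}$. $q\in\mathbb C_p$ satisfies $|1-q|_p<1$. $[x]_Q=\frac{1-Q^x}{1-Q}$ (so that $\lim_{Q\to1}[x]_Q=x$), and $[x]_Q^k$ means $([x]_Q)^k$. $X=X_d=\varprojlim_N(\mathbb Z/dp^N\mathbb Z)$, $a+dp^N\mathbb Z_p$ denotes $\{x\in X:x\equiv a\pmod{dp^N}\}$, $X^*=\bigcup_{0<a<dp,\,(a,p)=1}(a+dp\mathbb Z_p)$, and $pX=\{px:x\in X\}$. The character $\chi$ is viewed as a function on $X$ through reduction modulo $d$; $\chi(1/\beta)$ denotes its value at $1/\beta$. In scalars, exponents and $q$-numbers, $\beta$ stands for its image in $\mathbb Z_p$. The $q$-Bernoulli numbers with weight $\alpha$, $\widetilde\beta_{n,q}^{(\alpha)}$, are defined recursively by $\widetilde\beta_{0,q}^{(\alpha)}=1$ and, for $n\ge1$, $q\,(q^\alpha\widetilde\beta^{(\alpha)}+1)^n-\widetilde\beta_{n,q}^{(\alpha)}=\frac{\alpha}{[\alpha]_q}$ if $n=1$ and $=0$ if $n>1$, where after binomial expansion $(\widetilde\beta^{(\alpha)})^l$ is replaced by $\widetilde\beta_{l,q}^{(\alpha)}$. The $q$-Bernoulli polynomials with weight $\alpha$ are $\widetilde\beta_{n,q}^{(\alpha)}(x)=\sum_{l=0}^n\binom nl[x]_{q^\alpha}^{n-l}q^{\alpha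 l x}\,\widetilde\beta_{l,q}^{(\alpha)}$. Replacing $q$ by $q^M$ gives $\widetilde\beta_{n,q^M}^{(\alpha)}(x)$; at $x=a/M$ one takes $(q^M)^{a/M}=q^a$. The distribution $\mu_{k,q}^{(\alpha)}$ on the compact open subsets of $X$ is given by $\mu_{k,q}^{(\alpha)}(a+dp^N\mathbb Z_p)=\frac{[dp^N]_{q^\alpha}^k}{[dp^N]_q}\,q^a\,\widetilde\beta_{k,q^{dp^N}}^{(\alpha)}\left(\frac a{dp^N}\right)$, $0\le a<dp^N$, $N\in\mathbb Z_+$; $\mu_{k,q^{1/\beta}}^{(\alpha)}$ is the same with $q$ replaced by $q^{1/\beta}$. The generalized $q$-Bernoulli numbers with weight $\alpha$ attached to $\chi$ are $$\widetilde\beta_{n,\chi,q}^{(\alpha)}=\int_X\chi(x)[x]_{q^\alpha}^n\,d\mu_q(x)=\frac{[d]_{q^\alpha}^n}{[d]_q}\sum_{a=0}^{d-1}q^a\chi(a)\,\widetilde\beta_{n,q^d}^{(\alpha)}\left(\frac ad\right),$$ where $\int_X f\,d\mu_q=\lim_{N\to\infty}\frac1{[dp^N]_q}\sum_{x=0}^{dp^N-1}f(x)q^x$; in the claim, $\widetilde\beta_{k,\chi,q}^{(\alpha)}$ is regarded as a function $f(q)$ on which the operators $\chi^y$ act. For a distribution $\mu$ on $X$, $\int_X\chi\,d\mu=\lim_{N\to\infty}\sum_{x=0}^{dp^N-1}\chi(x)\mu(x+dp^N\mathbb Z_p)$, $\int_{pX}\chi\,d\mu=\lim_{N\to\infty}\sum_{x=0}^{dp^N-1}\chi(px)\mu(px+dp^{N+1}\mathbb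 Z_p)$, and $\int_{X^*}=\int_X-\int_{pX}$. The notation $d\mu_{k,q^{1/\beta}}^{(\alpha)}(\beta x)$ means integration against $U\mapsto\mu_{k,q^{1/\beta}}^{(\alpha)}(\beta U)$. The integral written with $d\mu_{k,\beta,q}^{(\alpha)}(\beta x)$ is expanded through the definition of $\mu_{k,\beta,q}^{(\alpha)}$ as integration against $d\mu_{k,q}^{(\alpha)}(x)-\beta^{-1}\frac{[\beta^{-1}]_{q^\alpha}^k}{[\beta^{-1}]_q}\,d\mu_{k,q^{1/\beta}}^{(\alpha)}(\beta x)$. *)

(* Defs.v *)
From mathcomp Require Import all_boot all_order all_algebra.
From mathcomp Require Import all_classical all_reals all_analysis.

Set Implicit Arguments.
Unset Strict Implicit.
Unset Printing Implicit Defensive.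

Import Order.TTheory GRing.Theory Num.Theory.
Import numFieldNormedType.Exports.

Local Open Scope classical_set_scope.
Local Open Scope ring_scope.

Section ValuedField.
Variables (R : realType) (K : fieldType) (abs : K -> R).

Definition abs_cvg (u : nat -> K) (l : K) : Prop :=
  abs (u n - l) @[n --> \oo] --> (0 : R).

Definition abs_cauchy (u : nat -> K) : Prop :=
  forall e : R, 0 < e ->
    exists N, forall m n, (N <= m)%N -> (N <= n)%N -> abs (u m - u n) < e.

Definition abs_closure (A : set K) : set K :=
  [set x | forall e : R, 0 < e -> exists2 y, A y & abs (x - y) < e].

(* The completion of the rationals inside K; it is Q_p as soon as K is
   complete, abs is ultrametric and abs p = 1/p. *)
Definition Qp_in : set K := abs_closure (range (@ratr K)).

Definition algebraic_over (F : set K) : set K :=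
  [set x | exists P : {poly K}, [/\ P != 0, forall i, F P`_i & root P x]].

End ValuedField.

(* A model of C_p, i.e., a completion of an algebraic closure of Q_p with its
   normalized absolute value: since the field is algebraically closed, the
   elements algebraic over Q_p form an algebraic closure of Q_p. C_p is
   determined by these properties up to an isometric isomorphism. *)
Record CpField (p : nat) (R : realType) := MkCpField {
  cp_sort :> closedFieldType ;
  cp_abs : cp_sort -> R ;
  cp_abs_ge0 : forall x, 0 <= cp_abs x ;
  cp_abs_eq0 : forall x, cp_abs x = 0 <-> x = 0 ;
  cp_absM : forall x y, cp_abs (x * y) = cp_abs x * cp_abs y ;
  cp_absD : forall x y, cp_abs (x + y) <= Num.max (cp_abs x) (cp_abs y) ;
  cp_absp : cp_abs p%:R = p%:R^-1 ;
  cp_complete : forall u, abs_cauchy cp_abs u -> exists l, abs_cvg cp_abs u l ;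
  cp_dense : abs_closure cp_abs (algebraic_over (Qp_in cp_abs)) = setT
}.

(* The inverse limit X of the Z/dp^N: x N is the residue of x modulo dp^N, in
   [0, dp^N) (the bound follows from the compatibility equation). *)
Record limX (p d : nat) := MkLimX {
  resX :> nat -> nat ;
  resX_compat : forall N, resX N = (resX N.+1 %% (d * p ^ N))%N
}.

Section X.
Variables p d : nat.
Implicit Types x y : limX p d.

Lemma dvdn_level N : (d * p ^ N %| d * p ^ N.+1)%N.
Proof. by rewrite expnSr mulnA dvdn_mulr. Qed.

Lemma natX_compat n N :
  (n %% (d * p ^ N) = (n %% (d * p ^ N.+1)) %% (d * p ^ N))%N.
Proof. by rewrite modn_dvdm // dvdn_level. Qed.

Lemma mulX_compat x y N :
  (x N * y N %% (d * p ^ N) =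
   (x N.+1 * y N.+1 %% (d * p ^ N.+1)) %% (d * p ^ N))%N.
Proof.
by rewrite modn_dvdm ?dvdn_level// (resX_compat x) (resX_compat y) modnMm.
Qed.

Definition natX (n : nat) : limX p d := MkLimX (natX_compat n).
Definition mulX x y : limX p d := MkLimX (mulX_compat x y).

(* a + dp^N Z_p *)
Definition cyl (N a : nat) : set (limX p d) :=
  [set x | x N = a %% (d * p ^ N)]%N.

Definition Xstar : set (limX p d) :=
  \bigcup_(a in [set a : nat | (0 < a < d * p)%N && coprime a p]) cyl 1 a.

End X.

Section DirichletCharacter.
Variable K : fieldType.
Implicit Type chi : nat -> K.

Definition dirichlet_character (d : nat) chi : Prop :=
  [/\ chi 1%N = 1,
      forall m n, chi (m * n)%N = chi m * chi n,
      forall n, chi (n + d)%N = chi n &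
      forall n, (chi n != 0) = coprime n d].

(* The character chi mod d factors through (Z/eZ)^* *)
Definition induced_from (d e : nat) chi : Prop :=
  (e %| d)%N /\
  forall m n, coprime m d -> coprime n d -> m = n %[mod e] -> chi m = chi n.

Definition dirichlet_conductor (d : nat) chi : Prop :=
  dirichlet_character d chi /\ forall e, induced_from d e chi -> (d <= e)%N.

(* chi(1/n); it is 0 when n is not invertible modulo d. *)
Definition chi_inv (d : nat) chi (n : nat) : K :=
  if [pick c : 'I_d | c * n == 1 %[mod d]] is Some c then chi c else 0.

End DirichletCharacter.

Section Weighted.
Variables (p : nat) (R : realType) (C : CpField p R).
Implicit Types (q Q : C) (chi : nat -> C).

Definition limC (u : nat -> C) : C :=
  xget 0 [set l | abs_cvg (@cp_abs p R C) u l].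

(* Q^y for y in Z_p: the value at y of the continuous extension of n |-> Q^n
   from the natural numbers to Z_p. *)
Definition ppow Q (y : C) : C :=
  xget 0 [set l | forall u : nat -> nat,
    abs_cvg (@cp_abs p R C) (fun n => (u n)%:R) y ->
    abs_cvg (@cp_abs p R C) (fun n => Q ^+ u n) l].

(* [x]_Q, where Qx stands for Q^x; it is x when Q = 1. *)
Definition qnum_of Q (x Qx : C) : C := if Q == 1 then x else (1 - Qx) / (1 - Q).

Definition qnum Q (x : C) : C := qnum_of Q x (ppow Q x).

(* The two sides of the recursion determine the whole sequence b if Q = 1 (the
   n-th equation then yields b (n-1)) or if Q is not a root of unity. *)
Definition qbern_rec (alpha : nat) Q (b : nat -> C) : Prop :=
  b 0%N = 1 /\
  forall n, (0 < n)%N ->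
    Q * (\sum_(l < n.+1) (Q ^+ alpha) ^+ l * b l *+ 'C(n, l)) - b n =
    if n == 1%N then alpha%:R / qnum Q alpha%:R else 0.

Definition qbern (alpha : nat) Q : nat -> C :=
  xget (fun=> 0) [set b | qbern_rec alpha Q b].

(* The polynomial with weight alpha at x, where Qx stands for Q^x. The two
   are separate arguments because x = a/M with Q = q^M and Q^x = q^a is
   needed, and such an x need not be in Z_p. *)
Definition qbern_poly (alpha n : nat) Q (x Qx : C) : C :=
  \sum_(l < n.+1)
    qnum_of (Q ^+ alpha) x (Qx ^+ alpha) ^+ (n - l) * Qx ^+ (alpha * l) *
    qbern alpha Q l *+ 'C(n, l).

Variable d : nat.

Definition lvl (N : nat) : nat := (d * p ^ N)%N.

(* The image of x under the projection of X = Z/d x Z_p onto Z_p. *)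
Definition Zp_of (x : limX p d) : C := limC (fun N => (x N)%:R).

(* mu_{k,q}(a + dp^N Z_p) for 0 <= a < dp^N. *)
Definition mu_cyl (alpha k : nat) q (N a : nat) : C :=
  qnum (q ^+ alpha) (lvl N)%:R ^+ k / qnum q (lvl N)%:R * q ^+ a *
  qbern_poly alpha k (q ^+ lvl N) (a%:R / (lvl N)%:R) (q ^+ a).

(* The distribution on compact open sets, by additivity: for N large a compact
   open U is the disjoint union of the a + dp^N Z_p that it contains, and the
   sum below no longer depends on N. *)
Definition mu (alpha k : nat) q (U : set (limX p d)) : C :=
  limC (fun N => \sum_(a < lvl N | `[< cyl N a `<=` U >]) mu_cyl alpha k q N a).

Definition mu_beta (alpha k : nat) (beta : limX p d) q
    (U : set (limX p d)) : C :=
  let ib := (Zp_of beta)^-1 in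
  mu alpha k q U -
  ib * (qnum (q ^+ alpha) ib ^+ k / qnum q ib) *
  mu alpha k (ppow q ib) [set mulX beta x | x in U].

Definition int_X chi (m : set (limX p d) -> C) : C :=
  limC (fun N => \sum_(x < lvl N) chi x * m (cyl N x)).

Definition int_pX chi (m : set (limX p d) -> C) : C :=
  limC (fun N => \sum_(x < lvl N) chi (p * x)%N * m (cyl N.+1 (p * x))).

Definition int_Xstar chi (m : set (limX p d) -> C) : C :=
  int_X chi m - int_pX chi m.

Definition qint q (f : limX p d -> C) : C :=
  limC (fun N => (qnum q (lvl N)%:R)^-1 *
                 \sum_(x < lvl N) f (natX p d x) * q ^+ x).

(* x 0 is the residue of x modulo d. *)
Definition qbern_chi (alpha n : nat) chi q : C :=
  qint q (fun x => chi (x 0%N) * qnum (q ^+ alpha) (Zp_of x) ^+ n).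

(* The operator chi^y, where c stands for chi(y) and y for its image in Z_p. *)
Definition chi_op (alpha k : nat) (c y : C) (f : C -> C) : C -> C :=
  fun q => qnum (q ^+ alpha) y ^+ k / qnum q y * c * f (ppow q y).

Definition one_minus (c : C) (T : (C -> C) -> (C -> C)) (f : C -> C) : C -> C :=
  fun q => f q - c * T f q.

End Weighted.

Arguments mu_beta {p R C d}.
Arguments int_Xstar {p R C d}.

(* Main.v *)
Require Import Defs.
From mathcomp Require Import all_boot all_order all_algebra.
From mathcomp Require Import all_classical all_reals all_analysis.
From mathcomp Require Import ring.

Set Implicit Arguments.
Unset Strict Implicit.
Unset Printing Implicit Defensive.

Import Order.TTheory GRing.Theory Num.Theory.
Import numFieldNormedType.Exports.
Local Open Scope ring_scope.

(** The distribution is a moment distribution: its value on a + d p^N Z_p is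
    the q-Volkenborn integral of [x]_(q^alpha)^k over that set,
<<
    lim_n  1/[d p^n]_q  \sum_(x < d p^n, x = a mod d p^N)  q^x [x]_(q^alpha)^k
>>
    Granting this, additivity is the splitting of a finite sum, and summing
    chi x against the values at any level N gives exactly the generalized
    Bernoulli number attached to chi (qbern_chiE), so that the limits over N
    in the definition of the integrals are limits of constant sequences.

    The moment formula (mu_cyl_cvg) follows from [a + M i] = [a] + q^a [M] [i]
    (in the appropriate bases), the binomial theorem, and the case of Z_p
    itself (qbern_cvg): the Bernoulli numbers are limits of the power sums
    \sum_(i < p^N) [i]^l Q^i / [p^N]_Q. Indeed the power sums satisfy the
    Bernoulli recursion up to a telescoping term whose limit is the prescribed
    right-hand side, and the recursion is triangular: it gives both the
    convergence, by induction, and the uniqueness of its solution. For natural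
    n the sum 1 + Q + ... + Q^(n-1) is [n]_Q whether or not Q is 1, which is
    why both cases are treated together.

    The four terms of the product on the right correspond to four sums.
    - Integrating over pX instead of X replaces q by q^p and multiplies by
      [p]_(q^alpha)^k / [p]_q chi(p), by the form of the distribution
      (mu_cyl_pmul).
    - beta is a unit at p, so that multiplication by beta maps the cylinder of
      x onto that of beta x (mulX_cyl), and summing chi x against values at
      beta x produces the factor chi(1/beta) (sum_chi_twist). When beta is not
      invertible modulo d this factor is 0, and the sum vanishes because chi
      is primitive.
    - The operators chi^p and chi^(1/beta) commute because [y p]_q can be
      expanded in two ways (qnum_qnatC), y being 1/beta. *)

(** * Congruences *)

Section Congruences.
Local Open Scope nat_scope.

Lemma coprime_inverse a n : coprime a n -> exists c, c * a = 1 %[mod n].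
Proof.
have [->|a0 an] := posnP a.
  by rewrite /coprime gcd0n => /eqP ->; exists 0; rewrite !modn1.
case: (egcdnP n a0) => c b E _; exists c.
by rewrite E (eqP an) modnMDl.
Qed.

Lemma eqmodMl a b c n : a = b %[mod n] -> c * a = c * b %[mod n].
Proof. by move=> ab; rewrite -modnMmr ab modnMmr. Qed.

Lemma eqmodMr a b c n : a = b %[mod n] -> a * c = b * c %[mod n].
Proof. by move=> ab; rewrite -modnMml ab modnMml. Qed.

Lemma eqmod_dvd a b m n : m %| n -> a = b %[mod n] -> a = b %[mod m].
Proof. by move=> mn ab; rewrite -(modn_dvdm a mn) ab modn_dvdm. Qed.

Lemma inverse_unique a b c n : b * a = 1 %[mod n] -> c * a = 1 %[mod n] ->
  b = c %[mod n].
Proof.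
move=> ba ca; rewrite -{1}[b]muln1 -(eqmodMl b ca) mulnCA.
by rewrite (eqmodMl c ba) muln1.
Qed.

Lemma eqmod_coprime a b n : a = b %[mod n] -> coprime a n = coprime b n.
Proof. by move=> ab; rewrite -coprime_modl ab coprime_modl. Qed.

Lemma periodic_eqmod T (f : nat -> T) d m n : (forall i, f (i + d) = f i) ->
  m = n %[mod d] -> f m = f n.
Proof.
move=> fd; suff f_modn i : f (i %% d) = f i by move=> mn; rewrite -f_modn mn.
rewrite [in RHS](divn_eq i d); elim: (i %/ d) => [|j IHj] //.
by rewrite mulSn -addnA addnC fd.
Qed.

Lemma big_coprime_reindex (V : nmodType) c L (F : nat -> V) :
  0 < L -> coprime c L ->
  (\sum_(x < L) F (c * x %% L)%N = \sum_(x < L) F x)%R.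
Proof.
move=> L0 /coprime_inverse[c' c'c].
pose h (x : 'I_L) := Ordinal (ltn_pmod (c * x) L0).
rewrite [RHS](reindex_inj (h := h))// => x y /(congr1 val) /= xy.
apply/val_inj; rewrite /= -(modn_small (ltn_ord x)) -(modn_small (ltn_ord y)).
have E (z : 'I_L) : c' * (c * z) = z %[mod L].
  by rewrite mulnA (eqmodMr z c'c) mul1n.
by rewrite -E (eqmodMl c' xy) E.
Qed.

End Congruences.

(** * Limits for an ultrametric absolute value *)

Section UltrametricLimits.
Variables (p : nat) (R : realType) (C : CpField p R).
Implicit Types (x y l m : C) (u v : nat -> C).

Local Notation abs := (@cp_abs p R C).
Local Notation cvgC := (abs_cvg abs).

Lemma abs0 : abs 0 = 0.
Proof. by apply/cp_abs_eq0. Qed.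

Lemma abs1 : abs 1 = 1.
Proof.
have n1 : abs 1 != 0 by apply/eqP => /cp_abs_eq0 /eqP; rewrite oner_eq0.
by apply: (mulfI n1); rewrite -cp_absM !mulr1.
Qed.

Lemma absX x n : abs (x ^+ n) = abs x ^+ n.
Proof. by elim: n => [|n IHn]; rewrite ?expr0 ?abs1// !exprS cp_absM IHn. Qed.

Lemma absN x : abs (- x) = abs x.
Proof.
suff n1 : abs (-1) = 1 by rewrite -mulN1r cp_absM n1 mul1r.
have := absX (-1) 2; rewrite sqrrN expr1n abs1 => /esym/eqP.
by rewrite sqrp_eq1 ?cp_abs_ge0// => /eqP.
Qed.

Lemma abs_distC x y : abs (x - y) = abs (y - x).
Proof. by rewrite -absN opprB. Qed.

Lemma abs_add_le x y (e : R) : abs x <= e -> abs y <= e -> abs (x + y) <= e.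
Proof. by move=> xe ye; rewrite (le_trans (cp_absD x y))// ge_max xe. Qed.

Lemma abs_add_lt x y (e : R) : abs x < e -> abs y < e -> abs (x + y) < e.
Proof. by move=> xe ye; rewrite (le_lt_trans (cp_absD x y))// gt_max xe. Qed.

Lemma abs_sum_le I (r : seq I) (P : pred I) (F : I -> C) (e : R) :
  0 <= e -> (forall i, P i -> abs (F i) <= e) ->
  abs (\sum_(i <- r | P i) F i) <= e.
Proof.
move=> e0 Fe; elim/big_ind: _ => [|x y|i]; rewrite ?abs0//.
- exact: abs_add_le.
- exact: Fe.
Qed.

Lemma abs_nat_le1 n : abs n%:R <= 1.
Proof.
elim: n => [|n IHn]; first by rewrite abs0 ler01.
by rewrite -natr1 abs_add_le ?abs1.
Qed.

Lemma abs_ball1 x : abs (1 - x) < 1 -> abs x <= 1.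
Proof.
move=> x1; rewrite -[x](subKr 1); apply: abs_add_le; first by rewrite abs1.
by rewrite absN ltW.
Qed.

Lemma abs_expB x y n : abs x <= 1 -> abs y <= 1 ->
  abs (x ^+ n - y ^+ n) <= abs (x - y).
Proof.
move=> x1 y1; rewrite subrXX cp_absM ler_piMr ?cp_abs_ge0//.
apply: abs_sum_le => // i _; rewrite cp_absM !absX.
by rewrite mulr_ile1 ?exprn_ge0 ?exprn_ile1 ?cp_abs_ge0.
Qed.

Lemma abs_cvgP u l : cvgC u l <->
  forall e : R, 0 < e -> exists N, forall n, (N <= n)%N -> abs (u n - l) < e.
Proof.
rewrite /abs_cvg; split => [/cvgrPdist_lt ul e e0|ul].
  have [N _ Nu] := ul e e0; exists N => n Nn.
  by have := Nu n Nn; rewrite /= sub0r normrN ger0_norm ?cp_abs_ge0.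
apply/cvgrPdist_lt => e e0; have [N Nu] := ul e e0; exists N => // n /= Nn.
by rewrite sub0r normrN ger0_norm ?cp_abs_ge0// Nu.
Qed.

Lemma cvgC_le u l (w : nat -> R) : (forall n, abs (u n - l) <= w n) ->
  (w n @[n --> \oo] --> (0 : R))%classic -> cvgC u l.
Proof.
move=> uw w0; apply: (squeeze_cvgr _ (cvg_cst 0) w0).
by apply: nearW => n; rewrite cp_abs_ge0 uw.
Qed.

Lemma cvgC_geom u l (r : R) : 0 <= r < 1 ->
  (forall n, abs (u n - l) <= r ^+ n) -> cvgC u l.
Proof.
move=> /andP[r0 r1] ur; apply: (cvgC_le ur); apply: cvg_expr.
by rewrite ger0_norm.
Qed.

Lemma cvgC_cst l : cvgC (fun=> l) l.
Proof. by apply/abs_cvgP => e e0; exists 0%N => n _; rewrite subrr abs0. Qed.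

Lemma cvgC_unshift u l N : cvgC (fun n => u (N + n)%N) l -> cvgC u l.
Proof.
move=> /abs_cvgP ul; apply/abs_cvgP => e /ul[M Mu].
exists (N + M)%N => n NMn; rewrite -(subnKC (leq_trans (leq_addr M N) NMn)).
by apply: Mu; rewrite leq_subRL ?(leq_trans (leq_addr M N) NMn).
Qed.

Lemma cvgC_near u v l N : (forall n, (N <= n)%N -> u n = v n) ->
  cvgC u l -> cvgC v l.
Proof.
move=> uv /abs_cvgP ul; apply/abs_cvgP => e /ul[M Mu].
exists (maxn N M) => n; rewrite geq_max => /andP[Nn Mn].
by rewrite -uv// Mu.
Qed.

Lemma cvgCD u v l m : cvgC u l -> cvgC v m -> cvgC (fun n => u n + v n) (l + m).
Proof.
move=> /abs_cvgP ul /abs_cvgP vm; apply/abs_cvgP => e e0.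
have [N Nu] := ul _ e0; have [M Mv] := vm _ e0.
exists (maxn N M) => n; rewrite geq_max => /andP[Nn Mn].
by rewrite opprD addrACA abs_add_lt ?Nu ?Mv.
Qed.

Lemma cvgCM u v l m : cvgC u l -> cvgC v m -> cvgC (fun n => u n * v n) (l * m).
Proof.
move=> ul vm; apply: (@cvgC_le _ _ (fun n => abs (u n - l) * abs (v n - m) +
  (abs (u n - l) * abs m + abs l * abs (v n - m)))) => [n|].
  have -> : u n * v n - l * m =
      (u n - l) * (v n - m) + ((u n - l) * m + l * (v n - m)) by ring.
  rewrite -!cp_absM; set a := _ * _; set b := _ * m; set c := l * _.
  have ge0 := @cp_abs_ge0 p R C.
  by rewrite !abs_add_le// ?lerDl ?lerDr ?addr_ge0//;
     rewrite ler_wpDl ?lerDl ?lerDr.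
have <- : 0 * 0 + (0 * abs m + abs l * 0) = 0.
  by rewrite !(mulr0, mul0r) !addr0.
by apply: cvgD; [exact: cvgM|apply: cvgD; apply: cvgM => //; exact: cvg_cst].
Qed.

Lemma cvgCMl u l m : cvgC u l -> cvgC (fun n => m * u n) (m * l).
Proof. exact/cvgCM/cvgC_cst. Qed.

Lemma cvgCB u v l m : cvgC u l -> cvgC v m -> cvgC (fun n => u n - v n) (l - m).
Proof.
move=> ul vm; apply: cvgCD => //; rewrite -mulN1r.
by under eq_fun do rewrite -mulN1r; exact: cvgCMl.
Qed.

Lemma cvgCX u l k : cvgC u l -> cvgC (fun n => u n ^+ k) (l ^+ k).
Proof.
move=> ul; elim: k => [|k IHk]; first exact: cvgC_cst.
by rewrite exprS; under eq_fun do rewrite exprS; exact: cvgCM.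
Qed.

Lemma cvgC_sum I (r : seq I) (P : pred I) (F : I -> nat -> C) (L : I -> C) :
  (forall i, P i -> cvgC (F i) (L i)) ->
  cvgC (fun n => \sum_(i <- r | P i) F i n) (\sum_(i <- r | P i) L i).
Proof.
move=> FL; elim: r => [|i r IHr].
  by rewrite big_nil; under eq_fun do rewrite big_nil; exact: cvgC_cst.
rewrite big_cons; under eq_fun do rewrite big_cons.
by case: ifP => // Pi; apply: cvgCD => //; exact: FL.
Qed.

Lemma cvgC_unique u l m : cvgC u l -> cvgC u m -> l = m.
Proof.
move=> ul um; apply/eqP/negPn/negP => lm.
have e0 : 0 < abs (l - m).
  rewrite lt_neqAle cp_abs_ge0 andbT eq_sym; apply/eqP => /cp_abs_eq0/eqP.
  by rewrite subr_eq0 (negPf lm).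
have [N Nu] := (abs_cvgP u l).1 ul _ e0.
have [M Mu] := (abs_cvgP u m).1 um _ e0.
set n := maxn N M; have un : abs (l - u n) < abs (l - m).
  by rewrite abs_distC Nu ?leq_maxl.
have := abs_add_lt un (Mu n (leq_maxr _ _)).
by rewrite subrKA ltxx.
Qed.

Lemma limCE u l : cvgC u l -> limC u = l.
Proof. by move=> ul; apply: xget_subset1 => // x y; exact: cvgC_unique. Qed.

Lemma limC_near u l N : (forall n, (N <= n)%N -> u n = l) -> limC u = l.
Proof.
move=> ul; apply: limCE; apply: (@cvgC_near (fun=> l) _ _ N) (cvgC_cst l).
by move=> n Nn; rewrite ul.
Qed.

End UltrametricLimits.

(** * q-numbers of natural numbers *)

Section QNumbers.
Variable K : comNzRingType.
Implicit Type Q : K.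

(** The q-number [n]_Q, without division so that Q = 1 is not special. *)
Definition qnat Q n : K := \sum_(i < n) Q ^+ i.

Lemma subr1_qnat Q n : (1 - Q) * qnat Q n = 1 - Q ^+ n.
Proof. by rewrite -[RHS]opprB subrX1 -mulNr opprB. Qed.

Lemma qnat_at1 n : qnat 1 n = n%:R :> K.
Proof.
rewrite /qnat; under eq_bigr do rewrite expr1n.
by rewrite sumr_const card_ord.
Qed.

Lemma qnatD Q m n : qnat Q (m + n) = qnat Q m + Q ^+ m * qnat Q n.
Proof.
rewrite /qnat big_split_ord /= mulr_sumr; congr (_ + _).
by apply: eq_bigr => i _; rewrite exprD.
Qed.

Lemma qnatM Q m n : qnat Q (m * n) = qnat Q m * qnat (Q ^+ m) n.
Proof.
elim: n => [|n IHn]; first by rewrite muln0 /qnat !big_ord0 mulr0.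
rewrite mulnS qnatD IHn -add1n qnatD /qnat big_ord1 expr0 expr1.
by rewrite mulrDr mulr1 mulrCA.
Qed.

Lemma qnat1 Q : qnat Q 1 = 1.
Proof. by rewrite /qnat big_ord1. Qed.

End QNumbers.

(** * p-adic exponents and q-numbers *)

Section PadicExponents.
Variables (p : nat) (R : realType) (C : CpField p R).
Hypothesis p_pr : prime p.
Implicit Types (Q x y z l : C) (u v : nat -> nat).

Local Notation abs := (@cp_abs p R C).
Local Notation cvgC := (abs_cvg abs).

Let p_gt0 : (0 < p)%N := prime_gt0 p_pr.

Lemma invp_ge0 : 0 <= p%:R^-1 :> R.
Proof. by rewrite invr_ge0 ler0n. Qed.

Lemma invp_lt1 : p%:R^-1 < 1 :> R.
Proof. by rewrite invf_lt1 ?ltr0n// ltr1n prime_gt1. Qed.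

(** By Bezout, 1 is an integral combination of n and p, and |p| < 1, so that
    |n| < 1 would contradict the ultrametric inequality. Since
    |p| is not 0 either, the field has characteristic 0. *)
Lemma abs_coprime n : coprime n p -> abs n%:R = 1.
Proof.
move=> np; apply/eqP; rewrite eq_le abs_nat_le1 /=.
have [n_eq0|n0] := posnP n; last first.
  have [a _ /eqP] := Bezoutl p n0; rewrite (eqP np) => /eqP.
  case/dvdnP => b /(congr1 (fun i => i%:R : C)); rewrite natrD !natrM => ab.
  have : abs (1 : C) <= Num.max (abs n%:R) p%:R^-1.
    rewrite -[X in abs X](addrK (a%:R * p%:R)) ab.
    rewrite (le_trans (cp_absD _ _))// absN !cp_absM cp_absp.
    rewrite ge_max !le_max !ler_piMl ?orbT ?abs_nat_le1 ?cp_abs_ge0 ?invp_ge0//.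
  by rewrite abs1 le_max (leNgt _ p%:R^-1) invp_lt1 orbF.
by move: np; rewrite n_eq0 /coprime gcd0n (gtn_eqF (prime_gt1 p_pr)).
Qed.

Lemma abs_natE n : (0 < n)%N -> abs n%:R = p%:R^-1 ^+ logn p n.
Proof.
move=> n0; have [m pm {1}->] := pfactor_coprime p_pr n0.
by rewrite natrM natrX cp_absM absX cp_absp abs_coprime ?mul1r 1?coprime_sym.
Qed.

Lemma natC_eq0 n : (n%:R == 0 :> C) = (n == 0)%N.
Proof.
have [->|n0] := posnP n; first by rewrite eqxx.
apply/negbTE/eqP => /cp_abs_eq0 /eqP.
by rewrite abs_natE// expf_eq0 invr_eq0 pnatr_eq0 (gtn_eqF p_gt0) andbF.
Qed.

Lemma dvdn_of_abs N n : abs n%:R < p%:R^-1 ^+ N -> (p ^ N %| n)%N.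
Proof.
have [->|n0] := posnP n; first by rewrite dvdn0.
rewrite abs_natE// ltr_iXn2l ?invp_lt1 ?invr_gt0 ?ltr0n// => Nn.
by rewrite pfactor_dvdn// ltnW.
Qed.

Section Ball.
Variable Q : C.
Hypothesis Q1 : abs (1 - Q) < 1.

(** The contraction factor: raising Q to the p-th power multiplies |1 - Q| by
    at most this number. *)
Definition radius : R := Num.max p%:R^-1 (abs (1 - Q)).

Lemma radius01 : 0 <= radius < 1.
Proof. by rewrite le_max cp_abs_ge0 orbT gt_max invp_lt1 Q1. Qed.

Lemma abs_1BX n : abs (1 - Q ^+ n) <= abs (1 - Q).
Proof. by rewrite -[X in X - _ ^+ _](expr1n _ n) abs_expB ?abs1 ?abs_ball1. Qed.

Lemma ballX n : abs (1 - Q ^+ n) < 1.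
Proof. exact: le_lt_trans (abs_1BX n) Q1. Qed.

Lemma absX_le1 n : abs (Q ^+ n) <= 1.
Proof. exact/abs_ball1/ballX. Qed.

Lemma abs_qnat_le1 n : abs (qnat Q n) <= 1.
Proof. by apply: abs_sum_le => // i _; exact: absX_le1. Qed.

(** [p]_Q differs from p by a sum of terms Q^i - 1. *)
Lemma abs_qnat_p (e : R) : radius <= e -> abs (qnat Q p) <= e.
Proof.
rewrite ge_max => /andP[pe Qe].
have -> : qnat Q p = p%:R - \sum_(i < p) (1 - Q ^+ i).
  by rewrite sumrB sumr_const card_ord subKr.
apply: abs_add_le; rewrite ?cp_absp// absN.
apply: abs_sum_le => [|i _]; first exact: le_trans invp_ge0 pe.
exact: le_trans (abs_1BX i) Qe.
Qed.

End Ball.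

Section BallPowers.
Variable Q : C.
Hypothesis Q1 : abs (1 - Q) < 1.

(** [p^N]_Q is the product of the [p]_(Q^(p^j)) for j < N, each at most the
    radius of Q. *)
Lemma abs_qnat_dvd N t : (p ^ N %| t)%N -> abs (qnat Q t) <= radius Q ^+ N.
Proof.
case/dvdnP => m ->; rewrite mulnC qnatM cp_absM.
apply: le_trans (ler_piMr (cp_abs_ge0 _) (abs_qnat_le1 (ballX Q1 _) m)) _.
have /andP[r0 _] := radius01 Q1.
elim: N => [|N IHN]; first by rewrite expn0 qnat1 abs1 expr0.
rewrite expnSr qnatM cp_absM exprSr ler_pM ?cp_abs_ge0//.
apply: abs_qnat_p; first exact: ballX.
by rewrite ge_max !le_max lexx abs_1BX ?orbT.
Qed.

Lemma abs_1BX_dvd N t : (p ^ N %| t)%N -> abs (1 - Q ^+ t) <= radius Q ^+ N.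
Proof.
move=> Nt; rewrite -subr1_qnat cp_absM.
by apply: le_trans (abs_qnat_dvd Nt); rewrite ler_piMl ?cp_abs_ge0 ?ltW.
Qed.

(** The function n |-> Q^n is uniformly continuous for the p-adic distance:
    this is what makes the extension to exponents in Z_p exist. *)
Lemma pow_unif_cont (e : R) : 0 < e -> exists2 a : R, 0 < a &
  forall m n, abs (m%:R - n%:R) < a -> abs (Q ^+ m - Q ^+ n) < e.
Proof.
move=> e0; have /andP[r0 r1] := radius01 Q1.
have [N rN] : exists N, radius Q ^+ N < e.
  have /cvgrPdist_lt/(_ _ e0)[N _ /(_ N (leqnn N)) /=] :
    (radius Q ^+ n @[n --> \oo] --> (0 : R))%classic.
    by apply: cvg_expr; rewrite ger0_norm.
  by rewrite sub0r normrN ger0_norm ?exprn_ge0// => rN; exists N.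
exists (p%:R^-1 ^+ N); first by rewrite exprn_gt0 ?invr_gt0 ?ltr0n.
suff le m n : (n <= m)%N -> abs (m%:R - n%:R) < p%:R^-1 ^+ N ->
    abs (Q ^+ m - Q ^+ n) < e.
  move=> m n; have [/le|/ltnW/le nm] := leqP n m; first exact.
  by rewrite abs_distC [X in _ -> X < _]abs_distC.
move=> nm; rewrite -natrB// => /dvdn_of_abs Nmn.
apply: le_lt_trans rN; rewrite abs_distC -(subnKC nm) exprD.
rewrite -[X in X - _]mulr1 -mulrBr cp_absM.
apply: le_trans (abs_1BX_dvd Nmn).
by rewrite ler_piMl ?cp_abs_ge0// absX_le1.
Qed.

(** The exponents in Z_p are given throughout by a sequence of natural numbers
    converging to them. *)
Lemma ppow_cvg u y : cvgC (fun n => (u n)%:R) y ->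
  cvgC (fun n => Q ^+ u n) (ppow Q y).
Proof.
move=> uy; suff [l ul] : exists l, forall v, cvgC (fun n => (v n)%:R) y ->
    cvgC (fun n => Q ^+ v n) l.
  rewrite /ppow; set P := (X in xget _ X).
  have /(@xgetPex _ 0 P)/(_ u uy) : exists l, P l by exists l.
  exact.
(* u and v are eventually close to each other; for v = u this is the Cauchy
   property *)
have close v (e : R) : cvgC (fun n => (v n)%:R) y -> 0 < e ->
    exists N, forall m n, (N <= m)%N -> (N <= n)%N ->
      abs (Q ^+ v m - Q ^+ u n) < e.
  move=> /abs_cvgP vy e0; have [a a0 Qa] := pow_unif_cont e0.
  have [N Nv] := vy a a0; have [M Mu] := (abs_cvgP _ _).1 uy a a0.
  exists (maxn N M) => m n; rewrite !geq_max => /andP[Nm _] /andP[_ Mn].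
  by apply: Qa; rewrite -(subrKA y) abs_add_lt ?Nv// abs_distC Mu.
have [l ul] : exists l, cvgC (fun n => Q ^+ u n) l.
  by apply: cp_complete => e; exact: close.
exists l => v vy; apply/abs_cvgP => e e0; have [N Nv] := close v e vy e0.
have [M Mu] := (abs_cvgP _ _).1 ul e e0.
exists (maxn N M) => n; rewrite geq_max => /andP[Nn Mn].
by rewrite -(subrKA (Q ^+ u n)) abs_add_lt ?Nv ?Mu.
Qed.

Lemma ppowE u y l : cvgC (fun n => (u n)%:R) y ->
  cvgC (fun n => Q ^+ u n) l -> ppow Q y = l.
Proof. by move=> /ppow_cvg Qy; exact: cvgC_unique. Qed.

Lemma ppow_nat n : ppow Q n%:R = Q ^+ n.
Proof. exact: (@ppowE (fun=> n) _ _ (cvgC_cst _) (cvgC_cst _)). Qed.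

Lemma ppow_ball u y : cvgC (fun n => (u n)%:R) y -> abs (1 - ppow Q y) < 1.
Proof.
move=> /ppow_cvg /abs_cvgP /(_ _ ltr01)[N /(_ N (leqnn N)) uN].
by rewrite -(subrKA (Q ^+ u N)) abs_add_lt// ballX.
Qed.

End BallPowers.

Lemma ppow1 u y : cvgC (fun n => (u n)%:R) y -> ppow (1 : C) y = 1.
Proof.
have b1 : abs (1 - 1) < 1 by rewrite subrr abs0.
move=> uy; apply: (ppowE b1 uy).
apply: (@cvgC_near _ _ _ (fun=> 1) _ _ 0) (cvgC_cst 1) => n _.
by rewrite expr1n.
Qed.

Lemma ppowX Q u y m : abs (1 - Q) < 1 -> cvgC (fun n => (u n)%:R) y ->
  ppow (Q ^+ m) y = ppow Q y ^+ m.
Proof.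
move=> Q1 uy; apply: (ppowE (ballX Q1 m) uy).
by under eq_fun do rewrite exprAC; apply: cvgCX; exact: ppow_cvg.
Qed.

(** The base Q^(u n) may be replaced by its limit uniformly in the exponent,
    since |a^m - b^m| <= |a - b| on the unit ball; hence the double limit is
    computed along the diagonal. *)
Lemma ppow_ppow Q u v y z : abs (1 - Q) < 1 ->
  cvgC (fun n => (u n)%:R) y -> cvgC (fun n => (v n)%:R) z ->
  ppow (ppow Q y) z = ppow Q (y * z).
Proof.
move=> Q1 uy vz; have Qy1 := ppow_ball Q1 uy.
apply: (ppowE Qy1 vz).
have uvyz : cvgC (fun n => (u n * v n)%:R) (y * z).
  by under eq_fun do rewrite natrM; exact: cvgCM.
have Quv := ppow_cvg Q1 uvyz.
rewrite -[ppow Q (y * z)]add0r.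
under eq_fun => n do rewrite -[ppow Q y ^+ v n](subrK (Q ^+ (u n * v n))).
apply: cvgCD Quv; have /abs_cvgP Qy := ppow_cvg Q1 uy.
apply/abs_cvgP => e /Qy[N NQ]; exists N => n /NQ.
apply: le_lt_trans; rewrite subr0 exprM abs_distC abs_expB//.
- exact: abs_ball1.
- exact: absX_le1.
Qed.

(** The condition put on the base q, stable under natural powers and under
    exponents that are units of Z_p. It makes [n]_Q nonzero for n > 0. *)
Definition qadmissible Q :=
  abs (1 - Q) < 1 /\ forall n : nat, (0 < n)%N -> Q ^+ n = 1 -> Q = 1.

Section Admissible.
Variable Q : C.
Hypothesis Q_adm : qadmissible Q.

Let Q1 : abs (1 - Q) < 1 := Q_adm.1.

Lemma qadm_eq1 n : (0 < n)%N -> (Q ^+ n == 1) = (Q == 1).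
Proof.
move=> n0; apply/eqP/eqP => [|->]; last exact: expr1n.
exact: Q_adm.2.
Qed.

Lemma qadmX n : qadmissible (Q ^+ n).
Proof.
split=> [|m m0]; first exact: ballX.
have [->|n0 /eqP] := posnP n; first by rewrite expr0.
by rewrite -exprM qadm_eq1 ?muln_gt0 ?n0// => /eqP ->; rewrite expr1n.
Qed.

Lemma qnat_neq0 n : (0 < n)%N -> qnat Q n != 0.
Proof.
move=> n0; have [->|nQ1] := eqVneq Q 1.
  by rewrite qnat_at1 natC_eq0 -lt0n.
apply/eqP => nz; have := subr1_qnat Q n; rewrite nz mulr0 => /esym/eqP.
by rewrite subr_eq0 eq_sym qadm_eq1// (negPf nQ1).
Qed.

Lemma qnum_nat n : qnum Q n%:R = qnat Q n.
Proof.
rewrite /qnum /qnum_of ppow_nat//; case: eqP => [->|/eqP nQ1].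
  by rewrite qnat_at1.
by rewrite -subr1_qnat mulrC mulKf// subr_eq0 eq_sym.
Qed.

(** Both sides are [y m]_Q. *)
Lemma qnum_qnatC u y m : cvgC (fun n => (u n)%:R) y -> (0 < m)%N ->
  qnum Q y * qnat (ppow Q y) m = qnat Q m * qnum (Q ^+ m) y.
Proof.
move=> uy m0; rewrite /qnum /qnum_of qadm_eq1//.
rewrite (ppowX _ Q1 uy); case: eqP => [QE|/eqP nQ1].
  by rewrite QE (ppow1 uy) !qnat_at1 mulrC.
rewrite mulrAC subr1_qnat -(subr1_qnat Q m).
have nQ1' : 1 - Q != 0 by rewrite subr_eq0 eq_sym.
by field; rewrite nQ1' qnat_neq0.
Qed.

End Admissible.

(** Raising to the power y recovers Q, so that a root of unity Q^(1/y) would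
    make Q a root of unity. *)
Lemma qadm_ppow Q u v y : qadmissible Q -> cvgC (fun n => (u n)%:R) y ->
  y != 0 -> cvgC (fun n => (v n)%:R) y^-1 -> qadmissible (ppow Q y^-1).
Proof.
move=> [Q1 Qroot] uy y0 vy; split; first exact: (ppow_ball Q1 vy).
have Qy1 := ppow_ball Q1 vy.
have QE : ppow (ppow Q y^-1) y = Q.
  by rewrite (ppow_ppow Q1 vy uy) mulVf// (ppow_nat Q1 1).
move=> n n0 Qn; suff -> : Q = 1 by exact: ppow1 vy.
by apply: (Qroot n n0); rewrite -QE -(ppowX _ Qy1 uy) Qn; exact: ppow1 uy.
Qed.

End PadicExponents.

(** * Bernoulli numbers as limits of power sums *)

Section PowerSums.
Variable K : comNzRingType.
Implicit Type Q : K.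

Definition qpsum (alpha : nat) Q k n : K :=
  \sum_(i < n) qnat (Q ^+ alpha) i ^+ k * Q ^+ i.

(** The left-hand side of the recursion defining the Bernoulli numbers. *)
Definition bern_op (alpha : nat) Q (s : nat -> K) n : K :=
  Q * (\sum_(l < n.+1) (Q ^+ alpha) ^+ l * s l *+ 'C(n, l)) - s n.

Lemma bern_opD alpha Q s t n :
  bern_op alpha Q (fun l => s l + t l) n =
  bern_op alpha Q s n + bern_op alpha Q t n.
Proof.
rewrite /bern_op opprD addrACA -mulrDr -big_split /=.
by under eq_bigr do rewrite mulrDr mulrnDl.
Qed.

Lemma bern_opM alpha Q s c n :
  bern_op alpha Q (fun l => s l * c) n = bern_op alpha Q s n * c.
Proof.
rewrite /bern_op mulrBl -mulrA mulr_suml.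
by under eq_bigr do rewrite mulrA -mulrnAl.
Qed.

(** Expanding [i + 1] = 1 + Q^alpha [i] turns Q times the sum into the power sum
    shifted by one, and the difference telescopes. *)
Lemma bern_op_qpsum alpha Q n M : (0 < n)%N ->
  bern_op alpha Q (qpsum alpha Q ^~ M) n = Q ^+ M * qnat (Q ^+ alpha) M ^+ n.
Proof.
move=> n0; elim: M => [|M IHM].
  rewrite /bern_op /qpsum /qnat !big_ord0 expr0n (gtn_eqF n0) mulr0 subr0.
  by rewrite big1 ?mulr0// => l _; rewrite big_ord0 mulr0 mul0rn.
have -> : qpsum alpha Q ^~ M.+1 =
    fun l => qpsum alpha Q l M + qnat (Q ^+ alpha) M ^+ l * Q ^+ M.
  by apply/funext => l; rewrite /qpsum big_ord_recr.
rewrite bern_opD IHM bern_opM /bern_op.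
have -> : \sum_(l < n.+1) (Q ^+ alpha) ^+ l * qnat (Q ^+ alpha) M ^+ l
      *+ 'C(n, l) = qnat (Q ^+ alpha) M.+1 ^+ n.
  rewrite -[M.+1]add1n qnatD qnat1 expr1 exprDn.
  by apply: eq_bigr => l _; rewrite expr1n mul1r exprMn.
by rewrite exprS; ring.
Qed.

End PowerSums.

Section BernoulliLimit.
Variables (p : nat) (R : realType) (C : CpField p R).
Hypothesis p_pr : prime p.
Variables (alpha : nat) (Q : C).
Hypotheses (alpha_gt0 : (0 < alpha)%N) (Q_adm : qadmissible Q).

Local Notation abs := (@cp_abs p R C).
Local Notation cvgC := (abs_cvg abs).
Let Q1 : abs (1 - Q) < 1 := Q_adm.1.
Let p_gt0 : (0 < p)%N := prime_gt0 p_pr.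

(** The recursion is triangular. If Q is not 1 the n-th equation determines
    s n, its coefficient being Q^(alpha n + 1) - 1; if Q = 1 the terms in s n
    cancel and the next equation determines s n, with coefficient n + 1.
    Neither a nor c depends on s: this serves for limits and for uniqueness. *)
Lemma bern_op_solve n : (0 < n)%N -> exists (m : nat) (a : C) (c : nat -> C),
  (0 < m)%N /\ forall s : nat -> C,
    s n = a * bern_op alpha Q s m + \sum_(l < n) c l * s l.
Proof.
move=> n0; have [QE|nQ1] := eqVneq Q 1.
  exists n.+1, n.+1%:R^-1, (fun l => - (n.+1%:R^-1 *+ 'C(n.+1, l))).
  split=> // s; rewrite /bern_op big_ord_recr big_ord_recr /= QE !expr1n.
  rewrite binn binSn !mul1r mulr1n addrK mulrDr mulr_sumr addrAC -big_split /=.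
  rewrite big1 ?add0r => [|l _]; last by rewrite expr1n mul1r; ring.
  have nz : n.+1%:R != 0 :> C by rewrite natC_eq0.
  by rewrite -[s n *+ _]mulr_natl mulKf.
have nz : Q * (Q ^+ alpha) ^+ n - 1 != 0.
  by rewrite subr_eq0 -exprM -exprS (qadm_eq1 Q_adm).
exists n, (Q * (Q ^+ alpha) ^+ n - 1)^-1, (fun l =>
  - ((Q * (Q ^+ alpha) ^+ n - 1)^-1 * (Q * ((Q ^+ alpha) ^+ l *+ 'C(n, l))))).
split=> // s; rewrite /bern_op big_ord_recr /= binn mulr1n.
set w := _^-1; set S := \sum_(l < n) _ *+ _.
have -> : \sum_(l < n) - (w * (Q * ((Q ^+ alpha) ^+ l *+ 'C(n, l)))) * s l =
    - (w * (Q * S)).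
  by rewrite !mulr_sumr -sumrN; apply: eq_bigr => l _; ring.
rewrite -[LHS](mulKf nz) -/w; ring.
Qed.

Lemma bern_op_unique (b b' : nat -> C) : b 0%N = b' 0%N ->
  (forall n, (0 < n)%N -> bern_op alpha Q b n = bern_op alpha Q b' n) ->
  b = b'.
Proof.
move=> bb0 bb; apply/funext => n; elim/ltn_ind: n => n IHn.
have [->//|n0] := posnP n.
have [m [a [c [m0 E]]]] := bern_op_solve n0; rewrite !{}E bb//.
by congr (_ + _); apply: eq_bigr => l _; rewrite IHn.
Qed.

Definition qmean l N := qpsum alpha Q l (p ^ N) / qnat Q (p ^ N).

Lemma cvgC_powp (t : C) : abs (1 - t) < 1 -> cvgC (fun N => t ^+ (p ^ N)) 1.
Proof.
move=> t1; apply: (cvgC_geom (radius01 p_pr t1)) => n.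
by rewrite abs_distC abs_1BX_dvd.
Qed.

Lemma cvgC_qnat_powp m : cvgC (fun N => qnat (Q ^+ (p ^ N)) m) m%:R.
Proof.
rewrite -(qnat_at1 C m) /qnat; apply: cvgC_sum => i _.
by apply: cvgCX; exact: cvgC_powp.
Qed.

(** The telescoping term is Q^M [M]_(Q^alpha)^n / [M]_Q with M = p^N. One factor
    [M]_(Q^alpha) / [M]_Q equals [alpha]_(Q^M) / [alpha]_Q and tends to
    alpha / [alpha]_Q; each further factor [M]_(Q^alpha) tends to 0. *)
Lemma bern_op_qmean_cvg n : (0 < n)%N ->
  cvgC (fun N => bern_op alpha Q (qmean ^~ N) n)
       (if n == 1%N then alpha%:R / qnum Q alpha%:R else 0).
Proof.
move=> n0; have A1 : abs (1 - Q ^+ alpha) < 1 by exact: ballX.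
have ratio M : (0 < M)%N -> qnat (Q ^+ alpha) M / qnat Q M =
    qnat (Q ^+ M) alpha / qnat Q alpha.
  move=> M0; apply/eqP; rewrite eqr_div ?(qnat_neq0 p_pr Q_adm)//.
  by rewrite mulrC -qnatM mulnC qnatM mulrC.
have -> : (if n == 1%N then alpha%:R / qnum Q alpha%:R else 0) =
    1 * (alpha%:R / qnat Q alpha) * 0 ^+ n.-1 :> C.
  rewrite qnum_nat// mul1r expr0n; case: n n0 => [|[|n]]//= _.
    by rewrite mulr1.
  by rewrite mulr0.
apply: (@cvgC_near _ _ _ (fun N => (Q ^+ (p ^ N) *
  (qnat (Q ^+ (p ^ N)) alpha / qnat Q alpha)) *
  qnat (Q ^+ alpha) (p ^ N) ^+ n.-1) _ _ 0) => [N _|].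
  rewrite -ratio ?expn_gt0 ?p_gt0// bern_opM bern_op_qpsum//.
  by rewrite -{2}(prednK n0) exprS; ring.
apply: cvgCM.
  apply: cvgCM; first exact: cvgC_powp.
  by apply: cvgCM; [exact: cvgC_qnat_powp | exact: cvgC_cst].
apply: cvgCX; apply: (cvgC_geom (radius01 p_pr A1)) => N.
by rewrite subr0 abs_qnat_dvd.
Qed.

Lemma qmean_cvg n : exists b, cvgC (qmean n) b.
Proof.
elim/ltn_ind: n => n IHn; have [->|n0] := posnP n.
  exists 1; apply: (@cvgC_near _ _ _ (fun=> 1) _ _ 0) (cvgC_cst 1) => N _.
  rewrite /qmean /qpsum; under eq_bigr do rewrite expr0 mul1r.
  by rewrite divff// (qnat_neq0 p_pr Q_adm)// expn_gt0 p_gt0.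
have [b bP] : exists b : nat -> C, forall l, (l < n)%N -> cvgC (qmean l) (b l).
  have /choice[b bP] : forall l, exists b, (l < n)%N -> cvgC (qmean l) b.
    move=> l; have [/IHn[b lb]|_] := ltnP l n; first by exists b.
    by exists 0.
  by exists b.
have [m [a [c [m0 E]]]] := bern_op_solve n0.
eexists; apply: (@cvgC_near _ _ _ (fun N => _) _ _ 0) => [N _|].
  by rewrite (E (qmean ^~ N)).
apply: cvgCD; first exact/cvgCMl/bern_op_qmean_cvg.
by apply: cvgC_sum => l _; apply/cvgCMl/bP.
Qed.

(** Limits of the power sums solve the recursion, which has one solution. *)
Lemma qbern_cvg l : cvgC (qmean l) (qbern alpha Q l).
Proof.
have /choice[b bP] := qmean_cvg.
suff recb : qbern_rec alpha Q b.
  suff -> : qbern alpha Q = b by [].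
  have [q0 qrec] : qbern_rec alpha Q (qbern alpha Q).
    by apply: (@xgetPex _ (fun=> 0) [set b | qbern_rec alpha Q b]%classic);
      exists b.
  apply: bern_op_unique => [|n n0]; first by rewrite q0 recb.1.
  by rewrite [LHS]qrec// [RHS](recb.2 n n0).
split.
  apply: (cvgC_unique (bP 0%N)).
  apply: (@cvgC_near _ _ _ (fun=> 1) _ _ 0) (cvgC_cst 1) => N _.
  rewrite /qmean /qpsum; under eq_bigr do rewrite expr0 mul1r.
  by rewrite divff// (qnat_neq0 p_pr Q_adm)// expn_gt0 p_gt0.
move=> n n0; apply: cvgC_unique (bern_op_qmean_cvg n0).
apply: cvgCB => //; apply: cvgCMl; apply: cvgC_sum => i _.
by under eq_fun do rewrite -mulrnAl; rewrite -mulrnAl; exact: cvgCMl.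
Qed.

End BernoulliLimit.

(** * The moment formula and additivity of the distribution *)

Section ResidueSums.
Variable V : nmodType.

Lemma sum_residue (M m a : nat) (f : nat -> V) : (a < M)%N ->
  \sum_(x < M * m | x == a %[mod M]) f x = \sum_(i < m) f (a + M * i)%N.
Proof.
move=> aM; elim: m => [|m IHm].
  by rewrite big_ord0 big1// => -[i]; rewrite muln0.
rewrite mulnS addnC big_split_ord IHm big_ord_recr /=; congr (_ + _).
rewrite (big_pred1 (Ordinal aM)) /=; first by rewrite addnC.
by move=> j; rewrite mulnC modnMDl !modn_small.
Qed.

(** Sorting the y < L by residue modulo M. *)
Lemma sum_by_residue (M L : nat) (P : pred nat) (F : nat -> nat -> V) :
  (0 < M)%N ->
  \sum_(a < M | P a) \sum_(y < L | y == a %[mod M]) F a y =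
  \sum_(y < L | P (y %% M)%N) F (y %% M)%N y.
Proof.
move=> M0; rewrite (exchange_big_dep predT)//= [RHS]big_mkcond /=.
apply: eq_bigr => y _; have yM : (y %% M < M)%N by rewrite ltn_mod.
rewrite [LHS](_ : _ = \sum_(a < M | a == Ordinal yM) if P a then F a y else 0).
  by rewrite big_pred1_eq.
rewrite -big_mkcondr; apply: eq_bigl => a; rewrite andbC -val_eqE /=.
by rewrite [(a %% M)%N]modn_small// eq_sym.
Qed.

End ResidueSums.

Section LimX.
Variables p d : nat.
Implicit Types x y : limX p d.

Lemma limX_modn x N n : (N <= n)%N -> x N = (x n %% (d * p ^ N))%N.
Proof.
move=> /subnK <-; elim: (n - N)%N => [|i IHi].
  by rewrite [x N]resX_compat modn_mod.
rewrite IHi addSn [x (i + N)%N]resX_compat modn_dvdm//.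
by rewrite expnD mulnCA dvdn_mull.
Qed.

Lemma limX_mod_self x N : (x N %% (d * p ^ N))%N = x N.
Proof. by rewrite -limX_modn. Qed.

Lemma cyl_subset N n a b : (N <= n)%N ->
  (@cyl p d n a `<=` @cyl p d N b)%classic <-> a = b %[mod d * p ^ N].
Proof.
move=> Nn.
have dvd : (d * p ^ N %| d * p ^ n)%N by rewrite dvdn_mul ?dvdn_exp2l.
split=> [|ab y].
  by move=> /(_ (natX p d a) erefl); rewrite /cyl /=.
by rewrite /cyl /= (limX_modn y Nn) => ->; rewrite modn_dvdm.
Qed.

End LimX.

Section Distribution.
Variables (p : nat) (R : realType) (C : CpField p R).
Hypothesis p_pr : prime p.
Variables (alpha k d : nat).
Hypotheses (alpha_gt0 : (0 < alpha)%N) (d_gt0 : (0 < d)%N).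

Local Notation abs := (@cp_abs p R C).
Local Notation cvgC := (abs_cvg abs).
Local Notation lvl := (lvl p d).
Let p_gt0 : (0 < p)%N := prime_gt0 p_pr.

Lemma lvl_gt0 N : (0 < lvl N)%N.
Proof. by rewrite muln_gt0 d_gt0 expn_gt0 p_gt0. Qed.

Lemma lvlD N n : lvl (N + n) = (lvl N * p ^ n)%N.
Proof. by rewrite /Defs.lvl expnD mulnA. Qed.

Lemma lvlS N : lvl N.+1 = (p * lvl N)%N.
Proof. by rewrite /Defs.lvl expnS mulnCA. Qed.

Section FixedQ.
Variable q : C.
Hypothesis q_adm : qadmissible q.

Let q1 : abs (1 - q) < 1 := q_adm.1.

(** The finite sums that approximate the integral of [x]^k over the set P. *)
Definition mu_approx (P : pred nat) n : C :=
  (\sum_(x < lvl n | P x) q ^+ x * qnat (q ^+ alpha) x ^+ k) / qnat q (lvl n).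

(** [a + M i] = [a] + A^a [M] [i] for the base A = q^alpha, where the first term
    is written as [M]_A [a/M]_(A^M). *)
Lemma qnat_affine M a i : (0 < M)%N ->
  qnat (q ^+ alpha) (a + M * i) = qnat (q ^+ alpha) M *
    (qnum_of ((q ^+ M) ^+ alpha) (a%:R / M%:R) ((q ^+ a) ^+ alpha) +
     (q ^+ a) ^+ alpha * qnat ((q ^+ M) ^+ alpha) i).
Proof.
move=> M0; rewrite qnatD qnatM mulrDr mulrCA ![(q ^+ _) ^+ alpha]exprAC.
congr (_ + _); rewrite /qnum_of.
have A_adm : qadmissible (q ^+ alpha) by exact: qadmX.
rewrite (qadm_eq1 A_adm)//; case: eqP => [->|/eqP A1].
  by rewrite !qnat_at1 mulrC divfK// natC_eq0// -lt0n.
rewrite -(subr1_qnat _ M) -(subr1_qnat _ a).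
have A1' : 1 - q ^+ alpha != 0 by rewrite subr_eq0 eq_sym.
by field; rewrite A1' (qnat_neq0 p_pr A_adm).
Qed.

(** The moment formula. In the definition of the Bernoulli polynomial, each
    Bernoulli number of base q^M is replaced by its power sums; qnat_affine and
    the binomial theorem reassemble them into sums over a + M i. *)
Lemma mu_cyl_cvg N a : (a < lvl N)%N ->
  cvgC (mu_approx (fun x => x == a %[mod lvl N])) (mu_cyl d alpha k q N a).
Proof.
move=> aN; set M := lvl N; have M0 : (0 < M)%N := lvl_gt0 N.
have Q_adm : qadmissible (q ^+ M) by exact: qadmX.
rewrite /mu_cyl !qnum_nat//; last exact: qadmX.
set u := a%:R / M%:R.
(* the coefficient of the l-th Bernoulli number in the polynomial *)
pose w l := qnum_of ((q ^+ M) ^+ alpha) u ((q ^+ a) ^+ alpha) ^+ (k - l) *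
  (q ^+ a) ^+ (alpha * l).
have lim : cvgC (fun n => qnat (q ^+ alpha) M ^+ k / qnat q M * q ^+ a *
      \sum_(l < k.+1) w l * qmean alpha (q ^+ M) l n *+ 'C(k, l))
    (qnat (q ^+ alpha) M ^+ k / qnat q M * q ^+ a *
     qbern_poly alpha k (q ^+ M) u (q ^+ a)).
  apply: cvgCMl; apply: cvgC_sum => l _; rewrite -mulrnAl.
  by under eq_fun do rewrite -mulrnAl; apply: cvgCMl; exact: qbern_cvg.
apply: (@cvgC_unshift _ _ _ _ _ N); apply: (@cvgC_near _ _ _ _ _ _ 0) lim.
move=> n _; rewrite /mu_approx lvlD -/M.
rewrite (sum_residue _ (fun x => q ^+ x * qnat (q ^+ alpha) x ^+ k))// qnatM.
have -> : \sum_(i < p ^ n)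
      q ^+ (a + M * i) * qnat (q ^+ alpha) (a + M * i) ^+ k =
    \sum_(l < k.+1) qnat (q ^+ alpha) M ^+ k * q ^+ a *
      (w l * qpsum alpha (q ^+ M) l (p ^ n) *+ 'C(k, l)).
  under [RHS]eq_bigr => l _ do
    rewrite /qpsum mulr_sumr -sumrMnl mulr_sumr.
  rewrite exchange_big /=; apply: eq_bigr => i _.
  rewrite qnat_affine// exprMn exprDn 2!mulr_sumr; apply: eq_bigr => l _.
  by rewrite exprD exprMn (exprM q M) -(exprM (q ^+ a)) /w; ring.
rewrite mulr_sumr mulr_suml; apply: eq_bigr => l _.
rewrite /qmean; have := qnat_neq0 p_pr q_adm M0.
have : qnat (q ^+ M) (p ^ n) != 0.
  by rewrite (qnat_neq0 p_pr Q_adm)// expn_gt0 p_gt0.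
by move=> ? ?; field; apply/andP.
Qed.

End FixedQ.
End Distribution.
Section Integrals.
Variables (p : nat) (R : realType) (C : CpField p R).
Hypothesis p_pr : prime p.
Variables (alpha k d : nat).
Hypotheses (alpha_gt0 : (0 < alpha)%N) (d_gt0 : (0 < d)%N).

Local Notation abs := (@cp_abs p R C).
Local Notation cvgC := (abs_cvg abs).
Local Notation lvl := (lvl p d).
Let p_gt0 : (0 < p)%N := prime_gt0 p_pr.
Let lvl_gt0 N : (0 < lvl N)%N := lvl_gt0 p_pr d_gt0 N.

Lemma Zp_of_natX m : Zp_of C (natX p d m) = m%:R.
Proof.
apply: (@limC_near _ _ _ _ _ m) => N mN.
rewrite /= modn_small//; apply: leq_trans (leq_pmull _ d_gt0).
exact: leq_trans (ltn_expl _ (prime_gt1 p_pr)) (leq_pexp2l p_gt0 mN).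
Qed.

Section FixedQ.
Variable q : C.
Hypothesis q_adm : qadmissible q.

Let q1 : abs (1 - q) < 1 := q_adm.1.

Lemma sum_mu_approx (F : nat -> C) N n :
  \sum_(a < lvl N)
    F a * mu_approx alpha k d q (fun x => x == a %[mod lvl N]) n =
  (\sum_(y < lvl n) F (y %% lvl N)%N * (q ^+ y * qnat (q ^+ alpha) y ^+ k)) /
  qnat q (lvl n).
Proof.
rewrite -(sum_by_residue _ predT (fun a y =>
  F a * (q ^+ y * qnat (q ^+ alpha) y ^+ k)))// mulr_suml.
by apply: eq_bigr => a _; rewrite /mu_approx mulrA mulr_sumr.
Qed.

(** Both sides are limits of the same finite sums. *)
Lemma mu_cyl_additive N n x : (N <= n)%N ->
  \sum_(a < lvl n | a == x %[mod lvl N]) mu_cyl d alpha k q n a =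
  mu_cyl d alpha k q N (x %% lvl N)%N.
Proof.
move=> Nn; have dvd : (lvl N %| lvl n)%N by rewrite dvdn_mul ?dvdn_exp2l.
have xN : (x %% lvl N < lvl N)%N by rewrite ltn_mod.
apply: (cvgC_unique (u := fun m => \sum_(a < lvl n | a == x %[mod lvl N])
    mu_approx alpha k d q (fun y => y == a %[mod lvl n]) m)).
  by apply: cvgC_sum => a _; exact: mu_cyl_cvg.
apply: (@cvgC_near _ _ _ _ _ _ 0)
  (mu_cyl_cvg p_pr k alpha_gt0 d_gt0 q_adm xN) => m _.
rewrite /mu_approx -mulr_suml; congr (_ / _).
rewrite (sum_by_residue _ (fun a => a == x %[mod lvl N])
  (fun _ y => q ^+ y * qnat (q ^+ alpha) y ^+ k))//.
by apply: eq_bigl => y; rewrite modn_mod modn_dvdm.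
Qed.

Lemma mu_cylE N x :
  mu alpha k q (@cyl p d N x) = mu_cyl d alpha k q N (x %% lvl N)%N.
Proof.
apply: (@limC_near _ _ _ _ _ N) => n Nn.
rewrite -(mu_cyl_additive _ Nn); apply: eq_bigl => a.
by apply/asboolP/eqP => /(cyl_subset p d _ _ Nn).
Qed.

(** The finite sums defining the integral of chi x [x]^k, sorted by residue
    modulo d p^N; the right-hand side is thus the same for all N. *)
Lemma qbern_chiE (chi : nat -> C) N : (forall n, chi (n + d)%N = chi n) ->
  qbern_chi d alpha k chi q =
  \sum_(x < lvl N) chi x * mu_cyl d alpha k q N x.
Proof.
move=> chi_per; apply: limCE.
apply: (@cvgC_near _ _ _ (fun n => \sum_(a < lvl N) chi a *
  mu_approx alpha k d q (fun x => x == a %[mod lvl N]) n) _ _ 0) => [n _|].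
  rewrite sum_mu_approx (qnum_nat p_pr q_adm) [RHS]mulrC; congr (_ / _).
  apply: eq_bigr => x _; rewrite Zp_of_natX (qnum_nat p_pr (qadmX q_adm _)).
  rewrite /= (periodic_eqmod chi_per (m := x %% lvl N) (n := x)); last first.
    by rewrite modn_dvdm ?dvdn_mulr.
  rewrite (periodic_eqmod chi_per (m := x %% (d * p ^ 0)) (n := x)); last first.
    by rewrite expn0 muln1 modn_mod.
  by rewrite mulrAC mulrA.
by apply: cvgC_sum => a _; apply: cvgCMl; exact: mu_cyl_cvg.
Qed.

End FixedQ.

(** [p L]_q = [p]_q [L]_(q^p), while the argument p x / (p L) = x / L of the
    polynomial and the powers of q only see q^p. *)
Lemma mu_cyl_pmul (q : C) N x : qadmissible q ->
  mu_cyl d alpha k q N.+1 (p * x) =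
  qnat (q ^+ alpha) p ^+ k / qnat q p * mu_cyl d alpha k (q ^+ p) N x.
Proof.
move=> q_adm; have A_adm : qadmissible (q ^+ alpha) by exact: qadmX.
have qp_adm : qadmissible (q ^+ p) by exact: qadmX.
have Ap_adm : qadmissible (q ^+ p ^+ alpha) by exact: qadmX.
rewrite /mu_cyl !qnum_nat// lvlS !(qnatM _ p (lvl N)) -!exprM.
have -> : (p * x)%:R / (p * lvl N)%:R = x%:R / (lvl N)%:R :> C.
  by rewrite !natrM -mulf_div divff ?mul1r// natC_eq0// -lt0n.
rewrite exprMn (mulnC alpha p); have := qnat_neq0 p_pr q_adm p_gt0.
have := qnat_neq0 p_pr qp_adm (lvl_gt0 N).
by move=> ? ?; field; apply/andP.
Qed.

End Integrals.

(** * Twisting by a primitive character *)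

Section Characters.
Variable K : fieldType.
Variables (d : nat) (chi : nat -> K).
Hypotheses (d_gt0 : (0 < d)%N) (chi_cond : dirichlet_conductor d chi).

Let chi1 : chi 1%N = 1. Proof. by have [[]] := chi_cond. Qed.
Let chiM m n : chi (m * n)%N = chi m * chi n.
Proof. by have [[]] := chi_cond. Qed.

Lemma chi_eqmod m n : m = n %[mod d] -> chi m = chi n.
Proof. by have [[_ _ chi_per _] _] := chi_cond; exact: periodic_eqmod. Qed.

Lemma chi_invE n c : (c * n = 1 %[mod d])%N -> chi_inv d chi n = chi c.
Proof.
move=> cn; rewrite /chi_inv; case: pickP => [c' /eqP c'n|].
  by apply: chi_eqmod; exact: inverse_unique c'n cn.
by move=> /(_ (Ordinal (ltn_pmod c d_gt0))) /=; rewrite modnMml cn eqxx.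
Qed.

Lemma chi_inv_eq0 n : ~~ coprime n d -> chi_inv d chi n = 0.
Proof.
move=> nd; rewrite /chi_inv; case: pickP => // c /eqP cn.
have := eqmod_coprime cn; rewrite coprimeMl (negPf nd) andbF.
by rewrite coprime1n.
Qed.

(** With g = gcd(b, d) > 1, the character does not factor through d/g by
    primitivity: it takes a value other than 1 at some c = 1 mod d/g, and
    b c = b mod d since g divides b. *)
Lemma primitive_witness b : ~~ coprime b d -> exists c,
  [/\ coprime c d, chi c <> 1 & (b * c = b %[mod d])%N].
Proof.
move=> bd; have [_ cond] := chi_cond; set g := gcdn b d.
have g0 : (0 < g)%N by rewrite gcdn_gt0 d_gt0 orbT.
have g1 : (1 < g)%N by rewrite ltn_neqAle eq_sym bd.
have dE : d = (g * (d %/ g))%N by rewrite mulnC divnK// dvdn_gcdr.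
have ltd : (d %/ g < d)%N by rewrite ltn_Pdiv.
have dvd : (d %/ g %| d)%N by rewrite {2}dE dvdn_mull.
apply: contrapT => no; move: ltd; rewrite ltnNge => /negP; apply.
apply: cond; split=> // m n md nd mn.
have [n' n'n] := coprime_inverse nd.
have n'd : coprime n' d.
  by have := eqmod_coprime n'n; rewrite coprimeMl coprime1n => /andP[].
apply: contrapT => chimn; apply: no; exists (m * n')%N; split.
- by rewrite coprimeMl md.
- move=> chi_eq1; apply: chimn.
  have := chiM (m * n') n; rewrite chi_eq1 mul1r => <-.
  by apply: chi_eqmod; rewrite -mulnA -[in LHS](muln1 m); exact/esym/eqmodMl.
- have one : (m * n' = 1 %[mod d %/ g])%N.
    by rewrite (eqmodMr n' mn) mulnC; exact: eqmod_dvd n'n.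
  have gE : (g * (m * n') = g * 1 %[mod g * (d %/ g)])%N.
    by rewrite -!muln_modr one.
  rewrite -dE muln1 in gE; rewrite -[b](divnK (dvdn_gcdl b d)) -/g -mulnA.
  exact: eqmodMl.
Qed.

(** If b is invertible modulo d, reindex by y = b x. Otherwise reindex by
    x |-> c x, with c given by primitive_witness: the values of G are
    unchanged and chi is multiplied by chi(c), so that the sum is 0. The factor
    e stands for p^N; c is lifted to be 1 modulo e. *)
Lemma sum_chi_twist (e b n : nat) (G : nat -> K) : (0 < e)%N -> coprime d e ->
  coprime b e -> n = b %[mod d] ->
  \sum_(x < d * e) chi x * G (b * x %% (d * e))%N =
  chi_inv d chi n * \sum_(x < d * e) chi x * G x.
Proof.
move=> e0 de be nb; set L := (d * e)%N.
have L0 : (0 < L)%N by rewrite muln_gt0 d_gt0.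
have chiL x : chi (x %% L)%N = chi x.
  by apply: chi_eqmod; rewrite modn_dvdm// dvdn_mulr.
have [bd|bd] := boolP (coprime b d).
  have [c cb] := coprime_inverse bd.
  rewrite (@chi_invE _ c); last by rewrite (eqmodMl c nb).
  have bL : coprime b L by rewrite coprimeMr bd.
  rewrite -(big_coprime_reindex (fun x => chi x * G x) L0 bL) mulr_sumr.
  apply: eq_bigr => x _; rewrite chiL chiM !mulrA -chiM.
  by rewrite (chi_eqmod cb) chi1 mul1r.
rewrite chi_inv_eq0 ?(eqmod_coprime nb)// mul0r.
have [c [cd chi_c bc]] := primitive_witness bd.
pose c' := chinese d e c 1.
have c'c : (c' = c %[mod d])%N by exact: chinese_modl.
have c'1 : (c' = 1 %[mod e])%N by exact: chinese_modr.
have c'L : coprime c' L.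
  by rewrite coprimeMr (eqmod_coprime c'c) cd (eqmod_coprime c'1) coprime1n.
have bc' : (b * c' = b %[mod L])%N.
  apply/eqP; rewrite chinese_remainder//.
  by rewrite (eqmodMl b c'c) bc (eqmodMl b c'1) muln1 !eqxx.
set S := LHS; suff : (chi c - 1) * S = 0.
  by move/eqP; rewrite mulf_eq0 subr_eq0 => /orP[/eqP //|/eqP].
rewrite mulrBl mul1r; apply/eqP; rewrite subr_eq0; apply/eqP.
rewrite {2}/S -(big_coprime_reindex
  (fun x => chi x * G (b * x %% L)%N) L0 c'L) mulr_sumr.
apply: eq_bigr => x _; rewrite chiL chiM (chi_eqmod c'c) mulrA.
by rewrite modnMmr mulnA (eqmodMr x bc').
Qed.

End Characters.

(** * Multiplication by an element prime to p *)

Section LimXUnits.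
Variables p d : nat.
Implicit Types x y b : limX p d.

Lemma limX_ext x y : (forall N, x N = y N) -> x = y.
Proof.
case: x y => [x xc] [y yc] /= xy; have E : x = y by exact/funext.
by move: E xc yc => {xy} -> xc yc; rewrite (Prop_irrelevance xc yc).
Qed.

Hypothesis pd : coprime p d.

Lemma coprime_lvl N : coprime d (p ^ N).
Proof. by rewrite coprimeXr// coprime_sym. Qed.

Lemma Xstar_coprime b N : Xstar b -> coprime (b N) (p ^ N).
Proof.
case=> a /= /andP[_ ap]; rewrite /cyl /= expn1 => ba.
case: N => [|N]; first by rewrite expn0 coprimen1.
apply: coprimeXr; rewrite -(@eqmod_coprime a)//.
apply: (@eqmod_dvd _ _ p (d * p)); first exact: dvdn_mull.
by rewrite -ba (limX_modn b (n := N.+1) (N := 1))// expn1 modn_mod.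
Qed.

(** A point y of the right-hand side is divided by b as follows: the quotient
    is a modulo d, where b need not be invertible, and y/b modulo p^n for
    each n; the Chinese remainder theorem glues the two. *)
Lemma mulX_cyl b N a : (forall n, coprime (b n) (p ^ n)) ->
  [set mulX b x | x in @cyl p d N a]%classic = @cyl p d N (b N * a).
Proof.
move=> bp; apply/seteqP; split=> [_ [x xa <-]|y yba].
  by rewrite /cyl /= in xa *; rewrite xa modnMmr.
have /choice[v vb] : forall n, exists c, (c * b n = 1 %[mod p ^ n])%N.
  by move=> n; exact: coprime_inverse.
have resp (x : limX p d) m n : (m <= n)%N -> (x m = x n %[mod p ^ m])%N.
  by move=> mn; rewrite (limX_modn x mn) modn_dvdm// dvdn_mull.
have resd (x : limX p d) m n : (m <= n)%N -> (x m = x n %[mod d])%N.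
  by move=> mn; rewrite (limX_modn x mn) modn_dvdm// dvdn_mulr.
pose z n := (chinese d (p ^ n) a (v n * y n) %% (d * p ^ n))%N.
have zL n : z n = (z n %% (d * p ^ n))%N by rewrite modn_mod.
have zd n : (z n = a %[mod d])%N.
  by rewrite modn_dvdm ?dvdn_mulr// chinese_modl// coprime_lvl.
have zp n : (z n = v n * y n %[mod p ^ n])%N.
  by rewrite modn_dvdm ?dvdn_mull// chinese_modr// coprime_lvl.
have eqX m n N' : (m = n %[mod d])%N -> (m = n %[mod p ^ N'])%N ->
    (m = n %[mod d * p ^ N'])%N.
  move=> md mp; apply/eqP; rewrite chinese_remainder ?coprime_lvl//.
  by rewrite md mp !eqxx.
have zc n : z n = (z n.+1 %% (d * p ^ n))%N.
  rewrite [LHS]zL; apply: eqX; first by rewrite !zd.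
  have dvd : (p ^ n %| p ^ n.+1)%N by rewrite dvdn_exp2l.
  rewrite zp (eqmod_dvd dvd (zp n.+1)) -(eqmodMl _ (resp y _ _ (leqnSn n))).
  apply: eqmodMr; apply: inverse_unique (vb n) _.
  by rewrite (eqmodMl _ (resp b _ _ (leqnSn n))); exact: eqmod_dvd (vb n.+1).
exists (MkLimX zc).
  rewrite /cyl /= [LHS]zL; apply: eqX => //.
  rewrite zp; have : (y N = b N * a %[mod p ^ N])%N.
    by rewrite yba modn_dvdm// dvdn_mull.
  by move=> /eqmodMl ->; rewrite mulnA (eqmodMr _ (vb N)) mul1n.
apply: limX_ext => n; rewrite /= -[RHS](limX_mod_self y); apply: eqX.
  rewrite (eqmodMl _ (zd n)).
  have [Nn|/ltnW nN] := leqP N n.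
    rewrite -(resd y _ _ Nn) yba modn_dvdm ?dvdn_mulr//.
    by apply: eqmodMr; rewrite (resd b _ _ Nn).
  rewrite (resd y _ _ nN) yba modn_dvdm ?dvdn_mulr//.
  by apply: eqmodMr; rewrite (resd b _ _ nN).
by rewrite (eqmodMl _ (zp n)) mulnA (mulnC (b n)) (eqmodMr _ (vb n)) mul1n.
Qed.

End LimXUnits.

(** * The projection onto Z_p *)

Section ZpProjection.
Variables (p : nat) (R : realType) (C : CpField p R) (d : nat).
Hypothesis p_pr : prime p.
Implicit Types x b : limX p d.

Local Notation abs := (@cp_abs p R C).
Local Notation cvgC := (abs_cvg abs).

Lemma abs_eqmod (m n N : nat) : (m = n %[mod p ^ N])%N ->
  abs (m%:R - n%:R) <= p%:R^-1 ^+ N.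
Proof.
wlog nm : m n / (n <= m)%N.
  move=> wl; have [/wl//|/ltnW /wl mn /esym /mn] := leqP n m.
  by rewrite abs_distC.
move=> /eqP; rewrite eqn_mod_dvd// -natrB// => /dvdnP[c ->].
by rewrite natrM natrX cp_absM absX cp_absp ler_piMl ?abs_nat_le1//.
Qed.

Let invp01 : 0 <= (p%:R^-1 : R) < 1.
Proof. by rewrite invp_ge0 invp_lt1. Qed.

Lemma invp_exp_lt (e : R) : 0 < e -> exists N, forall n, (N <= n)%N ->
  p%:R^-1 ^+ n < e.
Proof.
have : cvgC (fun n => p%:R ^+ n) 0.
  by apply: (cvgC_geom invp01) => n; rewrite subr0 absX cp_absp.
move=> /abs_cvgP small /small[N HN]; exists N => n /HN.
by rewrite subr0 absX cp_absp.
Qed.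

Lemma Zp_of_cvg x : cvgC (fun N => (x N)%:R) (Zp_of C x).
Proof.
suff [l xl] : exists l, cvgC (fun N => (x N)%:R) l by rewrite /Zp_of (limCE xl).
apply: cp_complete => e /invp_exp_lt[N HN]; exists N => m n Nm Nn.
apply: le_lt_trans (HN N (leqnn N)); apply: abs_eqmod.
have dvd : (p ^ N %| d * p ^ N)%N by exact: dvdn_mull.
by rewrite -(modn_dvdm (x m) dvd) -(modn_dvdm (x n) dvd) -!limX_modn.
Qed.

(** Inverses of b n modulo p^n are natural numbers converging to 1/b. *)
Lemma Zp_of_inv b : (forall n, coprime (b n) (p ^ n)) ->
  Zp_of C b != 0 /\
  exists v : nat -> nat, cvgC (fun n => (v n)%:R) (Zp_of C b)^-1.
Proof.
move=> bp; have b_cvg := Zp_of_cvg b; set y := Zp_of C b in b_cvg *.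
have /choice[v vb] : forall n, exists c, (c * b n = 1 %[mod p ^ n])%N.
  by move=> n; exact: coprime_inverse.
have y0 : y != 0.
  apply/eqP => y0; have [N HN] := (abs_cvgP _ _).1 b_cvg 1 ltr01.
  have := HN N.+1 (leqnSn N); rewrite y0 subr0 abs_coprime ?ltxx//.
  by have := bp N.+1; rewrite coprime_pexpr.
split=> //; exists v.
suff vy : cvgC (fun n => (v n)%:R * y) 1.
  have := cvgCMl y^-1 vy; rewrite mulr1.
  apply: (@cvgC_near _ _ _ _ _ _ 0) => n _.
  by rewrite mulrCA mulVf ?mulr1.
apply/abs_cvgP => e e0; have [N HN] := (abs_cvgP _ _).1 b_cvg e e0.
have [M HM] := invp_exp_lt e0; exists (maxn N M) => n.
rewrite geq_max => /andP[Nn Mn]; rewrite -(subrKA ((v n)%:R * (b n)%:R)).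
rewrite -mulrBr; apply: abs_add_lt; last first.
  rewrite -natrM; apply: le_lt_trans (HM n Mn).
  exact: abs_eqmod (vb n).
rewrite cp_absM abs_distC; apply: le_lt_trans (HN n Nn).
by rewrite ler_piMl ?cp_abs_ge0 ?abs_nat_le1.
Qed.

End ZpProjection.

Lemma sum_mulrBr (K : comNzRingType) (I : finType) (w F G : I -> K) (c : K) :
  \sum_i w i * (F i - c * G i) =
  \sum_i w i * F i - c * \sum_i w i * G i.
Proof.
rewrite mulr_sumr -sumrB; apply: eq_bigr => i _.
by rewrite mulrBr (mulrCA c).
Qed.

(** * The four integrals *)

Section MainIntegrals.
Variables (p : nat) (R : realType) (C : CpField p R).
Variables (alpha k d : nat) (chi : nat -> C) (beta : limX p d).
Hypotheses (p_pr : prime p) (alpha_gt0 : (0 < alpha)%N) (d_gt0 : (0 < d)%N).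
Hypotheses (pd : coprime p d) (chi_cond : dirichlet_conductor d chi).
Hypothesis beta_star : Xstar beta.
Implicit Type q : C.

Local Notation lvl := (lvl p d).
Local Notation chi_beta := (chi_inv d chi (beta 0%N)).
Let lvl_gt0 N : (0 < lvl N)%N := lvl_gt0 p_pr d_gt0 N.
Let beta_coprime N : coprime (beta N) (p ^ N) := Xstar_coprime N beta_star.

Let chi_per n : chi (n + d)%N = chi n.
Proof. by have [[]] := chi_cond. Qed.
Let chiM m n : chi (m * n)%N = chi m * chi n.
Proof. by have [[]] := chi_cond. Qed.

Lemma sum_chi_mu q N : qadmissible q ->
  \sum_(x < lvl N) chi x * mu alpha k q (@cyl p d N x) =
  qbern_chi d alpha k chi q.
Proof.
move=> q_adm; rewrite (qbern_chiE p_pr k alpha_gt0 d_gt0 q_adm N chi_per).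
by apply: eq_bigr => x _; rewrite (mu_cylE p_pr)// modn_small.
Qed.

Lemma sum_chi_mu_mulX q N : qadmissible q ->
  \sum_(x < lvl N)
    chi x * mu alpha k q [set mulX beta y | y in @cyl p d N x]%classic =
  chi_beta * qbern_chi d alpha k chi q.
Proof.
move=> q_adm; rewrite (qbern_chiE p_pr k alpha_gt0 d_gt0 q_adm N chi_per).
rewrite -(sum_chi_twist d_gt0 chi_cond (b := beta N))//.
- apply: eq_bigr => x _.
  by rewrite (mulX_cyl pd _ _ beta_coprime) (mu_cylE p_pr).
- by rewrite expn_gt0 prime_gt0.
- exact: coprime_lvl.
- by rewrite (limX_modn beta (leq0n N)) expn0 muln1 modn_mod.
Qed.

Lemma sum_chi_mu_pmul q N : qadmissible q ->
  \sum_(x < lvl N) chi (p * x)%N * mu alpha k q (@cyl p d N.+1 (p * x)) =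
  qnat (q ^+ alpha) p ^+ k / qnat q p * chi p *
    qbern_chi d alpha k chi (q ^+ p).
Proof.
move=> q_adm; rewrite -(sum_chi_mu N); last exact: qadmX.
rewrite mulr_sumr; apply: eq_bigr => x _.
rewrite !(mu_cylE p_pr)//; last exact: qadmX.
have -> : (p * x %% lvl N.+1 = p * (x %% lvl N))%N.
  by rewrite lvlS muln_modr.
by rewrite mu_cyl_pmul// chiM; ring.
Qed.

Lemma sum_chi_mu_mulX_pmul q N : qadmissible q ->
  \sum_(x < lvl N) chi (p * x)%N *
    mu alpha k q [set mulX beta y | y in @cyl p d N.+1 (p * x)]%classic =
  qnat (q ^+ alpha) p ^+ k / qnat q p * chi p *
    (chi_beta * qbern_chi d alpha k chi (q ^+ p)).
Proof.
move=> q_adm; rewrite -(sum_chi_mu_mulX N); last exact: qadmX.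
rewrite mulr_sumr; apply: eq_bigr => x _.
rewrite !(mulX_cyl pd _ _ beta_coprime) !(mu_cylE p_pr)//; last exact: qadmX.
have -> : (beta N.+1 * (p * x) %% lvl N.+1 = p * (beta N * x %% lvl N))%N.
  by rewrite (limX_modn beta (leqnSn N)) modnMml muln_modr lvlS mulnCA.
by rewrite mu_cyl_pmul// chiM; ring.
Qed.

End MainIntegrals.

Theorem mainTheorem5 (p : nat) (R : realType) (C : CpField p R) (q : C)
    (alpha k d : nat) (chi : nat -> C) (beta : limX p d) :
  prime p ->
  cp_abs (1 - q) < 1 ->
  (forall n : nat, (0 < n)%N -> q ^+ n = 1 -> q = 1) ->
  (0 < alpha)%N ->
  (0 < d)%N ->
  coprime p d ->
  dirichlet_conductor d chi ->
  Xstar beta ->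
  beta <> natX p d 1 ->
  int_Xstar chi (mu_beta alpha k beta q) =
  (one_minus 1 (chi_op alpha k (chi p) p%:R)
   \o one_minus (Zp_of C beta)^-1
        (chi_op alpha k (chi_inv d chi (beta 0%N)) (Zp_of C beta)^-1))
  (qbern_chi d alpha k chi) q.
Proof.
move=> p_pr q1 qroot alpha0 d0 pd chi_cond beta_star _.
have q_adm : qadmissible q by split.
have p0 := prime_gt0 p_pr.
have [y0 [v vib]] := Zp_of_inv C p_pr (fun N => Xstar_coprime N beta_star).
have uy := Zp_of_cvg C p_pr beta.
have q'_adm := qadm_ppow p_pr q_adm uy y0 vib.
rewrite /= /one_minus /chi_op /int_Xstar.
set ib := (Zp_of C beta)^-1 in vib q'_adm *.
have A_adm := qadmX q_adm alpha.
have qpib : ppow (q ^+ p) ib = ppow q ib ^+ p by exact: (ppowX p_pr p q1 vib).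
have qaib : ppow (q ^+ alpha) ib = ppow q ib ^+ alpha
  by exact: (ppowX p_pr alpha q1 vib).
set c := ib * (qnum (q ^+ alpha) ib ^+ k / qnum q ib).
have intX : int_X chi (mu_beta alpha k beta q) =
    qbern_chi d alpha k chi q -
    c * (chi_inv d chi (beta 0%N) * qbern_chi d alpha k chi (ppow q ib)).
  apply: (@limC_near _ _ _ _ _ 0) => N _.
  by rewrite /mu_beta -/ib -/c sum_mulrBr sum_chi_mu// sum_chi_mu_mulX.
have intpX : int_pX chi (mu_beta alpha k beta q) =
    qnat (q ^+ alpha) p ^+ k / qnat q p * chi p *
      qbern_chi d alpha k chi (q ^+ p) -
    c * (qnat (ppow q ib ^+ alpha) p ^+ k / qnat (ppow q ib) p * chi p *
      (chi_inv d chi (beta 0%N) *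
       qbern_chi d alpha k chi (ppow q ib ^+ p))).
  apply: (@limC_near _ _ _ _ _ 0) => N _.
  rewrite /mu_beta -/ib -/c sum_mulrBr sum_chi_mu_pmul//.
  by rewrite sum_chi_mu_mulX_pmul.
rewrite intX intpX !(ppow_nat p_pr q1) !(qnum_nat p_pr)// qpib.
have E1 := qnum_qnatC p_pr q_adm vib p0.
have E2 := qnum_qnatC p_pr A_adm vib p0.
rewrite qaib in E2.
(* [1/beta]_q [p]_(q^(1/beta)) = [p]_q [1/beta]_(q^p), and the same in base
   q^alpha *)
have E : c * (qnat (ppow q ib ^+ alpha) p ^+ k / qnat (ppow q ib) p) =
    qnat (q ^+ alpha) p ^+ k / qnat q p *
    (ib * (qnum (q ^+ p ^+ alpha) ib ^+ k / qnum (q ^+ p) ib)).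
  rewrite /c -mulrA mulrACA -invfM -exprMn E1 E2.
  by rewrite (exprAC q p alpha) exprMn invfM; ring.
set X := chi_inv _ _ _ * qbern_chi d alpha k chi (ppow q ib ^+ p).
have -> : c *
      (qnat (ppow q ib ^+ alpha) p ^+ k / qnat (ppow q ib) p * chi p * X) =
    c * (qnat (ppow q ib ^+ alpha) p ^+ k / qnat (ppow q ib) p) * (chi p * X).
  by rewrite !mulrA.
rewrite E /X /c; ring.
Qed.
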